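(* Let $\mu$ and $\nu$ be finite Borel measures on $\mathbb{R}$ with $0\in\operatorname{supp}\mu\subset[0,1]$ and $0\in\operatorname{supp}\nu\subset[0,1]$. Then $$\overline{\dim}_{loc}(\mu*\nu)(0)=\overline{\dim}_{loc}(\mu\times\nu)(0,0).$$
   Context: $\operatorname{supp}\mu$ is the support of $\mu$ and $B(x,r)$ is the ball of center $x$ and radius $r$. For a measure $\mu$ on a metric space and $x\in\operatorname{supp}\mu$, $\overline{\dim}_{loc}\mu(x)=\limsup_{r\to0}\frac{\log(\mu(B(x,r)))}{\log r}$. The convolution is $(\mu*\nu)(A)=\iint\chi_A(x+y)\,d\mu(x)\,d\nu(y)$. $\mu\times\nu$ is the product measure on $\mathbb{R}^2$, with the maximum metric, so that $B((x,y),r)=B(x,r)\times B(y,r)$. *)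

(* Defs.v *)
From HB Require Import structures.
From mathcomp Require Import all_boot all_order all_algebra.
From mathcomp Require Import all_classical all_reals all_analysis.
From mathcomp Require Import measurable_realfun.

Set Implicit Arguments.
Unset Strict Implicit.
Unset Printing Implicit Defensive.
Import Order.TTheory GRing.Theory Num.Theory.
Import numFieldNormedType.Exports.

Local Open Scope classical_set_scope.
Local Open Scope ring_scope.
Local Open Scope ereal_scope.

Definition supp {R : realType} {T : topologicalType} (mu : set T -> \bar R) :
    set T :=
  [set x | forall U, open_nbhs x U -> 0 < mu U].

(* The radius tends to 0 through positive values.  The logarithm is extended
   by lne 0 = -oo and lne +oo = +oo, and the value may be +oo.  [ball] is the
   open ball; on a product type it is the product of the balls of the factors,
   that is, the ball of the maximum metric. *)
Definition upper_local_dim {R : realType} {T : pseudoMetricType R}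
    (mu : set T -> \bar R) (x : T) : \bar R :=
  limf_esup (fun r : R => lne (mu (ball x r)) / lne r%:E) 0^'+.

Definition convolution {R : realType} (mu nu : set R -> \bar R) (A : set R) :
    \bar R :=
  \int[nu]_y \int[mu]_x (\1_A (x + y)%R)%:E.

Section convolution_measure.
Context {R : realType} (mu nu : {finite_measure set R -> \bar R}).

Let add (p : R * R) : R := (p.1 + p.2)%R.

Let measurable_add : measurable_fun [set: R * R] add.
Proof. by apply: measurable_funD. Qed.

Lemma convolutionE (A : set R) : measurable A ->
  convolution mu nu A = pushforward (mu \x^ nu) add A.
Proof.
move=> mA; apply: eq_integral => y _ /=.
have mAy : measurable ((fun x : R => x + y)%R @^-1` A).
  rewrite -[X in measurable X]setTI.
  by apply: (measurable_funD (measurable_id (D := setT)) (measurable_cst y)).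
rewrite -(setIT (_ @^-1` _)) in mAy.
have -> : ysection (add @^-1` A) y = (fun x : R => x + y)%R @^-1` A `&` setT.
  by rewrite setIT; apply/seteqP; split=> x; rewrite /ysection /= inE.
by rewrite -integral_indic ?setIT // -(setIT (_ @^-1` _)).
Qed.

Let convolution0 : convolution mu nu set0 = 0.
Proof. by rewrite convolutionE// /pushforward preimage_set0 measure0. Qed.

Let convolution_ge0 A : 0 <= convolution mu nu A.
Proof.
by apply: integral_ge0 => y _; apply: integral_ge0 => x _; rewrite lee_fin.
Qed.

Let convolution_sigma_additive : semi_sigma_additive (convolution mu nu).
Proof.
move=> F mF tF mUF; rewrite convolutionE//.
under eq_fun do under eq_bigr do rewrite convolutionE//.
exact: (@measure_semi_sigma_additive _ _ _ (pushforward (mu \x^ nu) add)).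
Qed.

HB.instance Definition _ := isMeasure.Build _ _ _ (convolution mu nu)
  convolution0 convolution_ge0 convolution_sigma_additive.

Let convolution_finite : fin_num_fun (convolution mu nu).
Proof.
apply: lty_fin_num_fun; rewrite [ltLHS]convolutionE// /pushforward preimage_setT.
rewrite -setXTT product_measure2E//.
by rewrite lte_mul_pinfty ?fin_num_measure ?ltey_eq ?fin_num_measure.
Qed.

HB.instance Definition _ :=
  Measure_isFinite.Build _ _ _ (convolution mu nu) convolution_finite.

End convolution_measure.

(* Main.v *)
Require Import Defs.
From HB Require Import structures.
From mathcomp Require Import all_boot all_order all_algebra.
From mathcomp Require Import all_classical all_reals all_analysis.
From mathcomp Require Import measurable_realfun lra.
Import Order.TTheory GRing.Theory Num.Theory.
Import numFieldNormedType.Exports.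
Local Open Scope classical_set_scope.
Local Open Scope ring_scope.

(** Write [f r] for the product of the masses that [mu] and [nu] give to the
    ball [B(0, r)]: it is the mass that the product measure gives to the ball
    of radius [r] around [(0, 0)].  The convolution gives to [B(0, r)] the
    product mass of the strip [|x + y| < r].  The strip contains the square
    [B(0, r/2) x B(0, r/2)], by the triangle inequality.  Conversely, measures
    supported in [[0, 1]] do not charge the negative reals, and in the
    quadrant [x, y >= 0] the strip lies in the square [B(0, r) x B(0, r)].
    Hence
      [f (r / 2) <= (mu * nu)(B(0, r)) <= f r]
    ([convolution_ball_ge], [convolution_ball_le]).

    Dividing logarithms by [ln r < 0] reverses these inequalities, and the
    halved radius does not matter in the limit because
    [ln (r / 2) = ln r - ln 2] and [ln r] tends to [-oo].  Both comparisons of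
    upper local dimensions are instances of [limf_esup_log_ratio], with
    scaling factors 1/2 and 1. *)

(** * Null sets outside the support *)

(** A null neighbourhood of a point contains a ball around that point with
    rational centre and radius, and there are countably many such balls. *)
Lemma supp_negligible (R : realType) (mu : {measure set R -> \bar R})
  (A : set R) : A `<=` ~` supp mu -> mu.-negligible A.
Proof.
move=> AS.
pose B (q : rat * rat) : set R := ball (ratr q.1 : R) (ratr q.2).
(* [F] enumerates the null rational balls. *)
pose F n : set R := if unpickle n is Some q then
  (if mu (B q) == 0%E then B q else set0) else set0.
apply: (@negligibleS _ _ _ _ (\bigcup_n F n)); last first.
  apply: negligible_bigcup => n; rewrite /F.
  case: unpickle => [q|]; last exact: negligible_set0.
  case: eqP => [B0|_]; last exact: negligible_set0.
  by apply/negligibleP => //; exact: measurable_ball.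
move=> x /AS /existsNP[U /not_implyP[[oU Ux]]] /negP; rewrite -leNgt => muU.
have [c [r /= [/set_mem xB BU]]] := open_subball_rat oU (mem_set Ux).
have muB : mu (B (c, r)) == 0%E.
  rewrite eq_le measure_ge0 andbT (le_trans _ muU)// le_measure ?inE//.
    exact: measurable_ball.
  exact: open_measurable.
exists (pickle (c, r)); first exact: I.
by rewrite /F pickleK muB.
Qed.

Lemma supp_ball_gt0 (R : realType) (mu : {measure set R -> \bar R}) (x r : R) :
  supp mu x -> 0 < r -> (0 < mu (ball x r))%E.
Proof. by move=> mux r0; apply: mux; exact: ball_open_nbhs. Qed.

Lemma measurable_lt0 (R : realType) : measurable [set x : R | x < 0].
Proof. by rewrite -set_itvNyo; exact: measurable_itv. Qed.

Lemma supp01_lt0 (R : realType) (mu : {measure set R -> \bar R}) :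
  supp mu `<=` `[0, 1] -> mu [set x : R | x < 0] = 0%E.
Proof.
move=> mu01; apply/negligibleP; first exact: measurable_lt0.
apply: supp_negligible => x /= + /mu01 /=.
by rewrite in_itv/= => x0 /andP[]; rewrite leNgt x0.
Qed.

(** * Upper limits of logarithmic ratios *)

(** Comparison of upper limits through eventual real upper bounds, with an
    arbitrarily small loss; it covers upper limits equal to [-oo] or [+oo]. *)
Lemma limf_esup_le_eps (R : realType) (T : choiceType) (X : filteredType T)
    (f g : X -> \bar R) (F : set_system X) : Filter F ->
  (forall K e : R, 0 < e -> (\forall x \near F, (g x <= K%:E)%E) ->
     \forall x \near F, (f x <= (K + e)%:E)%E) ->
  (limf_esup f F <= limf_esup g F)%E.
Proof.
move=> FF fg; rewrite [leRHS]limf_esupE.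
apply: le_ereal_inf_tmp => _ [V FV <-].
have H K e : 0 < e -> (ereal_sup (g @` V) <= K%:E)%E ->
    (limf_esup f F <= (K + e)%:E)%E.
  move=> e0 VK; have gK : \forall x \near F, (g x <= K%:E)%E.
    apply: filterS FV => x Vx; apply: le_trans VK.
    by apply: ereal_sup_ubound; exists x.
  pose W := [set x | (f x <= (K + e)%:E)%E].
  apply: ge_ereal_inf; exists (ereal_sup (f @` W)).
    by exists W => //; exact: fg.
  by apply: ge_ereal_sup => _ [x /= fx <-].
case: (ereal_sup _) H => [s| |] H.
- by apply/lee_addgt0Pr => e e0; rewrite -EFinD; exact: H.
- by rewrite leey.
- case: (limf_esup f F) H => [s| |] // H; last by have := H 0 1 ltr01 (leNye _).
  have := H (s - 2 : R) 1 ltr01 (leNye _); rewrite lee_fin => ?; exfalso; lra.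
Qed.

Lemma log_ratio_anti (R : realType) (r : R) (x y : \bar R) : 0 < r < 1 ->
  (0 < x)%E -> (x <= y)%E -> (y < +oo)%E ->
  (lne y / lne r%:E <= lne x / lne r%:E)%E.
Proof.
move=> /andP[r0 r1] x0 xy yoo.
have xoo := le_lt_trans xy yoo; have y0 := lt_le_trans x0 xy.
case: x x0 xy xoo => // x x0 xy _; case: y y0 xy yoo => // y y0 xy _.
have lr : ln r < 0 by rewrite ln_lt0// r0.
rewrite !lne_EFin// inver lt_eqF// -!EFinM lee_fin ler_nM2r ?invr_lt0//.
by rewrite ler_ln.
Qed.

Lemma log_ratio_le_EFin (R : realType) (r K : R) (x : \bar R) : 0 < r < 1 ->
  (0 < x)%E -> (x < +oo)%E ->
  (lne x / lne r%:E <= K%:E)%E = (K * ln r <= ln (fine x)).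
Proof.
move=> /andP[r0 r1]; case: x => // x x0 _.
have lr : ln r < 0 by rewrite ln_lt0// r0.
by rewrite !lne_EFin// inver lt_eqF// -EFinM lee_fin ler_ndivrMr.
Qed.

Lemma near0_scale (R : realType) (c : R) (P : R -> Prop) : 0 < c ->
  (\forall r \near 0^'+, P r) -> \forall r \near 0^'+, P (c * r).
Proof.
move=> c0 [e /= e0 eP]; exists (e / c); first by rewrite /= divr_gt0.
move=> r /= re r0; apply: eP; last by rewrite mulr_gt0.
move: re; rewrite /= !sub0r !normrN !gtr0_norm ?mulr_gt0//.
by rewrite ltr_pdivlMr// mulrC.
Qed.

(** If [n r] dominates [m (c * r)], then the logarithmic ratio of [n] has the
    smaller upper limit: for [r < 1] the ratio decreases in the mass, and in
    [ln (c * r) = ln c + ln r] the constant [ln c] is negligible against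
    [ln r], which tends to [-oo]. *)
Lemma limf_esup_log_ratio (R : realType) (m n : R -> \bar R) (c : R) :
  0 < c ->
  (forall r, 0 < r -> (0 < m r)%E) -> (forall r, 0 < r -> (n r < +oo)%E) ->
  (forall r, 0 < r -> (m (c * r)%R <= n r)%E) ->
  (limf_esup (fun r => lne (n r) / lne r%:E)%E 0^'+ <=
   limf_esup (fun r => lne (m r) / lne r%:E)%E 0^'+)%E.
Proof.
move=> c0 m0 noo mn; apply: limf_esup_le_eps => K e e0.
move=> /(near0_scale _ c _ c0) mK.
(* Makes the error [K * ln c / ln r] of the change of radius at most [e]. *)
have lnsmall : \forall r \near 0%R^'+, ln r <= K * ln c / e.
  by apply: cvgrNy_le; exact: lnNy.
near=> r.
have r0 : 0 < r by near: r; exact: nbhs_right_gt.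
have r1 : r < 1 by near: r; exact: nbhs_right_lt.
have cr0 : 0 < c * r by rewrite mulr_gt0.
have cr1 : c * r < 1.
  rewrite mulrC -ltr_pdivlMr//; near: r; apply: nbhs_right_lt.
  by rewrite divr_gt0.
have mr := m0 _ cr0.
apply: (@le_trans _ _ (lne (m (c * r)%R) / lne r%:E)%E).
  by apply: log_ratio_anti; rewrite ?r0 ?mn ?noo.
have moo : (m (c * r)%R < +oo)%E := le_lt_trans (mn _ r0) (noo _ r0).
have : (lne (m (c * r)%R) / lne (c * r)%:E <= K%:E)%E by near: r.
rewrite !log_ratio_le_EFin ?r0 ?cr0 ?cr1 ?r1//; apply: le_trans.
rewrite lnM// mulrDl mulrDr addrC lerD2r.
have : ln r <= K * ln c / e by near: r.
by rewrite ler_pdivlMr// mulrC.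
Unshelve. all: by end_near. Qed.

(** * Masses of balls *)

Lemma product_ball (R : realType) (mu nu : {finite_measure set R -> \bar R})
    (x y r : R) :
  (mu \x nu)%E (ball (x, y) r) = (mu (ball x r) * nu (ball y r))%E.
Proof. by rewrite -product_measure1E//; exact: measurable_ball. Qed.

Lemma convolution_ball (R : realType)
    (mu nu : {finite_measure set R -> \bar R}) (r : R) :
  convolution mu nu (ball 0%R r) =
  (mu \x^ nu)%E [set p : R * R | `|p.1 + p.2| < r].
Proof.
rewrite convolutionE; last exact: measurable_ball.
by rewrite /pushforward; congr ((mu \x^ nu)%E _); apply/seteqP; split=> p /=;
  rewrite /ball /= sub0r normrN.
Qed.

Lemma measurable_add_ball (R : realType) (r : R) :
  measurable [set p : R * R | `|p.1 + p.2| < r].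
Proof.
rewrite [X in measurable X](_ : _ =
    (fun p : R * R => p.1 + p.2) @^-1` (ball 0 r)).
  rewrite -[X in measurable X]setTI.
  by apply: measurable_funD => //; exact: measurable_ball.
by apply/seteqP; split=> p /=; rewrite /ball /= sub0r normrN.
Qed.

Lemma convolution_ball_ge (R : realType)
    (mu nu : {finite_measure set R -> \bar R}) (r : R) :
  (mu (ball 0%R (2^-1 * r)%R) * nu (ball 0%R (2^-1 * r)%R) <=
   convolution mu nu (ball 0%R r))%E.
Proof.
rewrite convolution_ball -product_measure2E; [|exact: measurable_ball..].
apply: le_measure; rewrite ?inE.
- by apply: measurableX; exact: measurable_ball.
- exact: measurable_add_ball.
move=> [x y] [] /=; rewrite /ball /= !sub0r !normrN => xr yr.
by rewrite (le_lt_trans (ler_normD _ _))// [r]splitr ltrD// mulrC.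
Qed.

Lemma convolution_ball_le (R : realType)
    (mu nu : {finite_measure set R -> \bar R}) (r : R) :
  mu [set x : R | x < 0] = 0%E -> nu [set x : R | x < 0] = 0%E ->
  (convolution mu nu (ball 0%R r) <=
   mu (ball 0%R r) * nu (ball 0%R r))%E.
Proof.
move=> mu0 nu0; rewrite convolution_ball.
have mN := measurable_lt0 R.
pose S := ball 0%R r `*` ball 0%R r : set (R * R).
pose A := [set x : R | x < 0] `*` [set: R].
pose B := [set: R] `*` [set x : R | x < 0].
have mS : measurable S by apply: measurableX; exact: measurable_ball.
have mA : measurable A by exact: measurableX.
have mB : measurable B by exact: measurableX.
have SE : (mu \x^ nu)%E S = (mu (ball 0%R r) * nu (ball 0%R r))%E.
  by rewrite product_measure2E//; exact: measurable_ball.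
have AE : (mu \x^ nu)%E A = 0%E.
  by rewrite product_measure2E// [X in (X * _)%E]mu0 mul0e.
have BE : (mu \x^ nu)%E B = 0%E.
  by rewrite product_measure2E// [X in (_ * X)%E]nu0 mule0.
(* [A] and [B] are null and cover the strip outside the first quadrant, where
   the strip lies in [S]. *)
apply: (@le_trans _ _ ((mu \x^ nu)%E (S `|` (A `|` B)))).
  apply: le_measure; rewrite ?inE.
  - exact: measurable_add_ball.
  - by apply: measurableU => //; exact: measurableU.
  move=> [x y] /= xyr; rewrite /S /A /B /ball /=.
  have [x0|x0] := ltP x 0; first by right; left.
  have [y0|y0] := ltP y 0; first by right; right.
  left; move: xyr; rewrite /= !sub0r !normrN !ger0_norm ?addr_ge0// => xyr.
  by split; apply: le_lt_trans xyr; rewrite ?lerDl ?lerDr.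
apply: le_trans (measureU2 _ _ _) _ => //; first exact: measurableU.
rewrite -[leRHS]adde0; apply: leeD; first by rewrite [leLHS]SE.
apply: le_trans (measureU2 _ mA mB) _.
by rewrite -[leRHS]adde0; apply: leeD; rewrite ?[leLHS]AE ?[leLHS]BE.
Qed.

(** * Equality of the dimensions *)

Theorem theorem4p1 (R : realType) (mu nu : {finite_measure set R -> \bar R})
    (mu0 : supp mu 0) (mu01 : supp mu `<=` `[0, 1])
    (nu0 : supp nu 0) (nu01 : supp nu `<=` `[0, 1]) :
  upper_local_dim (convolution mu nu) 0 =
  upper_local_dim (mu \x nu)%E (0, 0).
Proof.
pose f r := (mu (ball 0%R r) * nu (ball 0%R r))%E.
have fE r : (mu \x nu)%E (ball (0, 0) r) = f r by exact: product_ball.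
have f0 r : 0 < r -> (0 < f r)%E.
  by move=> r0; rewrite mule_gt0//; exact: supp_ball_gt0.
have foo r : (f r < +oo)%E.
  rewrite ltey_eq fin_numM// fin_num_measure//; exact: measurable_ball.
have cf r : (convolution mu nu (ball 0%R r) <= f r)%E.
  by apply: convolution_ball_le; exact: supp01_lt0.
have fc r : (f (2^-1 * r)%R <= convolution mu nu (ball 0%R r))%E.
  exact: convolution_ball_ge.
rewrite /upper_local_dim; under [in RHS]eq_fun do rewrite fE.
apply/eqP; rewrite eq_le; apply/andP; split.
- apply: (@limf_esup_log_ratio _ _ _ 2^-1) => // r _.
  exact: le_lt_trans (cf r) (foo r).
- apply: (@limf_esup_log_ratio _ _ _ 1) => // r r0.
    by apply: lt_le_trans (fc r); rewrite f0// mulr_gt0.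
  by rewrite mul1r.
Qed.
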